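(* Let $\alpha,\beta\in\mathbb{N}^{\ast}$. Then $g_{0,q}^{(\alpha,\beta)}=0$, and for every $n\in\mathbb{N}$, \[ q^{-\alpha}\left(q^{\alpha}g_{q}^{(\alpha,\beta)}+1\right)^{n}+g_{n,q}^{(\alpha,\beta)}=\begin{cases}[2]_{q^{\beta}}, & n=1,\\ 0, & n>1,\end{cases} \] where the left-hand side is read with the umbral convention: expand by the binomial theorem and replace $\left(g_{q}^{(\alpha,\beta)}\right)^{k}$ by $g_{k,q}^{(\alpha,\beta)}$.
   Context: Let $p$ be a fixed odd prime, $\mathbb{Z}_p$ the ring of $p$-adic integers, $\mathbb{C}_p$ the completion of an algebraic closure of $\mathbb{Q}_p$, and $q\in\mathbb{C}_p$ with $|q-1|_p<1$. $\mathbb{N}=\{1,2,\dots\}$, $\mathbb{N}^{\ast}=\mathbb{N}\cup\{0\}$. The $q$-number is $[x]_q=\frac{1-q^x}{1-q}$. For a uniformly differentiable function $f$ on $\mathbb{Z}_p$, the fermionic $p$-adic $q$-integral is \[ \int_{\mathbb{Z}_p}f(\xi)\,d\mu_{-q}(\xi)=\lim_{N\to\infty}\frac{1}{[p^N]_{-q}}\sum_{\xi=0}^{p^N-1}q^{\xi}f(\xi)(-1)^{\xi}, \] and $d\mu_{-q^{\beta}}$ denotes the same with $q$ replaced by $q^{\beta}$. The modified $q$-Genocchi polynomials with weight $\alpha$ and $\beta$ are defined for $n\in\mathbb{N}^{\ast}$ by \[ \frac{g_{n+1,q}^{(\alpha,\beta)}(x)}{n+1}=\int_{\mathbb{Z}_p}q^{-\beta\xi}[x+\xi]_{q^{\alpha}}^{n}\,d\mu_{-q^{\beta}}(\xi),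 \] with $g_{0,q}^{(\alpha,\beta)}=0$; the $q$-Genocchi numbers with weight $\alpha$ and $\beta$ are $g_{n,q}^{(\alpha,\beta)}=g_{n,q}^{(\alpha,\beta)}(0)$. *)

(* Defs.v *)
From HB Require Import structures.
From mathcomp Require Import all_boot all_order all_algebra.
From mathcomp Require Import all_classical all_reals all_analysis.
Set Implicit Arguments.
Unset Strict Implicit.
Unset Printing Implicit Defensive.
Import Order.TTheory GRing.Theory Num.Theory.
Local Open Scope classical_set_scope.
Local Open Scope ring_scope.

(* A field with a nonarchimedean absolute value.  The library's norms satisfy
   |x *+ n| = n |x| and hence exclude this case; the absolute value is therefore a
   field of the record, and only the metric |y - x| it induces is registered
   with the library. *)
Record ultrametricField (R : realType) := UltrametricField {
  uf_field : fieldType ;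
  uf_abs : uf_field -> R ;
  uf_abs_ge0 : forall x, 0 <= uf_abs x ;
  uf_abs_eq0 : forall x, uf_abs x = 0 <-> x = 0 ;
  uf_absM : forall x y, uf_abs (x * y) = uf_abs x * uf_abs y ;
  uf_absD : forall x y, uf_abs (x + y) <= Num.max (uf_abs x) (uf_abs y)
}.

Definition uf_sort (R : realType) (K : ultrametricField R) : Type := uf_field K.
Coercion uf_sort : ultrametricField >-> Sortclass.

HB.instance Definition _ (R : realType) (K : ultrametricField R) :=
  GRing.Field.copy (uf_sort K) (uf_field K).

Definition absv (R : realType) (K : ultrametricField R) : K -> R := @uf_abs R K.

Section UltrametricTopology.
Variables (R : realType) (K : ultrametricField R).
Implicit Types x y z : K.

Lemma absv_ge0 x : 0 <= absv x. Proof. exact: uf_abs_ge0. Qed.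

Lemma absv_eq0 x : absv x = 0 <-> x = 0. Proof. exact: uf_abs_eq0. Qed.

Lemma absvM x y : absv (x * y) = absv x * absv y. Proof. exact: uf_absM. Qed.

Lemma absvD x y : absv (x + y) <= Num.max (absv x) (absv y).
Proof. exact: uf_absD. Qed.

Lemma absv1 : absv (1 : K) = 1.
Proof.
have n0 : absv (1 : K) != 0.
  by apply/eqP => /absv_eq0/eqP; rewrite oner_eq0.
by apply: (mulfI n0); rewrite mulr1 -absvM mulr1.
Qed.

Lemma absvN x : absv (- x) = absv x.
Proof.
have absN1 : absv (- 1 : K) = 1.
  apply/eqP; rewrite -(@eqrXn2 _ 2) ?ler01 ?absv_ge0// expr1n expr2.
  by rewrite -absvM mulrNN mulr1 absv1.
by rewrite -mulN1r absvM absN1 mul1r.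
Qed.

Let dist x y : R := absv (y - x).

Let distxx x : dist x x = 0. Proof. by rewrite /dist subrr; exact/absv_eq0. Qed.

Let dist_eq0 x y : dist x y = 0 -> x = y.
Proof. by move/absv_eq0/subr0_eq. Qed.

Let dist_sym x y : dist x y = dist y x.
Proof. by rewrite /dist -opprB absvN. Qed.

Let dist_triangle y x z : dist x z <= dist x y + dist y z.
Proof.
have -> : dist x z = absv ((y - x) + (z - y)).
  by rewrite /dist [y - x + _]addrC subrKA.
apply: le_trans (absvD _ _) _.
by rewrite ge_max lerDl lerDr !absv_ge0.
Qed.

HB.instance Definition _ := isPointed.Build (uf_sort K) 0.
HB.instance Definition _ := @isMetric.Build R (uf_sort K)
  dist distxx dist_eq0 dist_sym dist_triangle.

(* The closure of Q.  When K is complete and |p| = 1/p for a prime p, the induced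
   absolute value on Q is the p-adic one and this is its completion Q_p. *)
Definition Qp : set K := closure (range (ratr : rat -> K)).

(* The elements algebraic over Q_p. *)
Definition Qp_alg : set K :=
  [set x | exists P : {poly K}, [/\ P != 0, forall i, Qp P`_i & root P x]].

End UltrametricTopology.

(* C_p as the completion of an algebraic closure of Q_p: a complete field, with
   absolute value normalized by |p| = 1/p, in which the elements algebraic over
   Q_p form an algebraically closed and dense subfield.  For p prime this
   determines C_p up to isometric isomorphism. *)
Record CpType (R : realType) (p : nat) := {
  Cp_field :> ultrametricField R ;
  Cp_complete : forall F : set_system Cp_field,
    ProperFilter F -> cauchy F -> cvg F ;
  Cp_abs_p : absv (p%:R : Cp_field) = p%:R^-1 ;
  Cp_alg_closed : forall P : {poly Cp_field},
    (1 < size P)%N -> (forall i, Qp_alg P`_i) ->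
    exists2 x, Qp_alg x & root P x ;
  Cp_alg_dense : closure (@Qp_alg R Cp_field) = setT
}.

Section Genocchi.
Variables (R : realType) (p : nat) (C : CpType R p).
Implicit Types (q x : C) (f : C -> C) (n a b : nat).

(* q^x for x in Z_p and |q - 1| < 1, by the binomial series
   sum_k binom(x, k) (q - 1)^k. *)
Definition padic_pow q x : C :=
  lim (series (fun k => (\prod_(i < k) (x - i%:R)) / k`!%:R * (q - 1) ^+ k)
       @ \oo).

(* The q-number [n]_q for a natural number n and arbitrary q (the base -q occurs,
   for which q^x does not extend to Z_p).  For q = 1 it is the limit value n. *)
Definition qnat q n : C := if q == 1 then n%:R else (1 - q ^+ n) / (1 - q).

(* The q-number [x]_q for x in Z_p and |q - 1| < 1.  For q = 1 it is the limit
   value x; this case does occur below, as q^a = 1 for a = 0 and also when q is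
   a root of unity of order dividing a. *)
Definition qnum q x : C :=
  if q == 1 then x else (1 - padic_pow q x) / (1 - q).

(* The integral of f over Z_p against mu_{-q}.  Only the values of f on the
   natural numbers, a dense subset of Z_p, enter the formula. *)
Definition fermionic_int q f : C :=
  lim ((qnat (- q) (p ^ N))^-1 *
        \sum_(0 <= xi < p ^ N) q ^+ xi * f xi%:R * (-1) ^+ xi @[N --> \oo]).

Definition genocchi_poly a b q n x : C :=
  if n is m.+1 then
    m.+1%:R * fermionic_int (q ^+ b) (fun xi =>
      padic_pow q (- (b%:R * xi)) * qnum (q ^+ a) (x + xi) ^+ m)
  else 0.

Definition genocchi a b q n : C := genocchi_poly a b q n 0.

End Genocchi.

(* Umbral evaluation: the linear map {poly K} -> K sending 'X^k to g k. *)
Definition umbral (K : nzRingType) (g : nat -> K) (P : {poly K}) : K :=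
  \sum_(k < size P) P`_k * g k.

(* Main.v *)
Require Import Defs.
From mathcomp Require Import all_boot all_order all_algebra.
From mathcomp Require Import all_classical all_reals all_analysis.
From mathcomp Require Import ring.
Import Order.TTheory GRing.Theory Num.Theory.
Set Implicit Arguments.
Unset Strict Implicit.
Unset Printing Implicit Defensive.
Local Open Scope ring_scope.
Local Open Scope classical_set_scope.

(* Write Q = q^a and B = q^b.  At natural numbers the factor q^(-b xi) of the
   integrand cancels the weight B^xi, so the m-th moment is the limit of
     [p^N]_{-B}^-1 * sum_(xi < p^N) (-1)^xi [xi]_Q^m.
   As [xi + 1]_Q = 1 + Q [xi]_Q, adding the sums over [xi + 1]_Q^m and [xi]_Q^m
   telescopes to 0^m + [p^N]_Q^m.  Since [p^N]_Q tends to 0 and 1 + Q^m is a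
   unit, this recurrence in m gives both the existence of the limits and, in the
   limit, the umbral identity, through k C(n, k) = n C(n - 1, k - 1). *)

(** * Ultrametric estimates and limits of sequences *)

Section Ultrametric.
Variables (R : realType) (K : ultrametricField R).
Implicit Types (x y q l : K) (u v : nat -> K).

Lemma absv0 : absv (0 : K) = 0.
Proof. exact/absv_eq0. Qed.

Lemma absvX x n : absv (x ^+ n) = absv x ^+ n.
Proof. by elim: n => [|n IHn]; rewrite ?expr0 ?absv1// !exprS absvM IHn. Qed.

Lemma absvV x : absv x^-1 = (absv x)^-1.
Proof.
have [->|x0] := eqVneq x 0; first by rewrite !invr0 absv0 invr0.
have ax0 : absv x != 0 by apply/eqP => /absv_eq0/eqP; exact/negP.
by apply: (mulfI ax0); rewrite -absvM !divff ?absv1.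
Qed.

Lemma absvD_le x y (c : R) : absv x <= c -> absv y <= c -> absv (x + y) <= c.
Proof. by move=> xc yc; apply: le_trans (absvD _ _) _; rewrite ge_max xc. Qed.

Lemma absvD_lt x y (c : R) : absv x < c -> absv y < c -> absv (x + y) < c.
Proof.
by move=> xc yc; apply: le_lt_trans (absvD _ _) _; rewrite gt_max xc.
Qed.

Lemma absv_sum (I : Type) (r : seq I) (P : pred I) (F : I -> K) (c : R) :
  0 <= c -> (forall i, P i -> absv (F i) <= c) ->
  absv (\sum_(i <- r | P i) F i) <= c.
Proof.
move=> c0 Fc; elim/big_ind: _ => [|x y|i Pi]; last exact: Fc.
  by rewrite absv0.
exact: absvD_le.
Qed.

Lemma absv_nat n : absv (n%:R : K) <= 1.
Proof.
elim: n => [|n IHn]; first by rewrite absv0.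
by rewrite -natr1 absvD_le// absv1.
Qed.

(** If [absv y] were below 1, then so would be the absolute value of [x = y - (y - x)]. *)
Lemma absv_eq1 x y : absv x = 1 -> absv (y - x) < 1 -> absv y = 1.
Proof.
move=> x1 yx; apply/le_anti/andP; split.
  by rewrite -[y](subrK x) absvD_le ?x1// ltW.
rewrite leNgt; apply/negP => y1.
suff: absv x < 1 by rewrite x1 ltxx.
by rewrite -[x](subKr y) absvD_lt// absvN.
Qed.

Lemma absv_neq0 x : absv x = 1 -> x != 0.
Proof.
move=> x1; apply/eqP => x0; move: x1.
by rewrite x0 absv0 => /esym/eqP; rewrite oner_eq0.
Qed.

Lemma absv_unit q : absv (q - 1) < 1 -> absv q = 1.
Proof. by apply: absv_eq1; rewrite absv1. Qed.

(** The cofactor of [q - 1] is a sum of powers of the unit [q]. This carries the hypothesis on [q]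
    over to the bases [q ^+ a] and [q ^+ b]. *)
Lemma absv_exprB1 q n : absv (q - 1) < 1 -> absv (q ^+ n - 1) <= absv (q - 1).
Proof.
move=> q1; rewrite subrX1 absvM ler_piMr ?absv_ge0//.
by apply: absv_sum => // i _; rewrite absvX absv_unit ?expr1n.
Qed.

Lemma cvg_absvP u l : u @ \oo --> l <->
  forall e : R, 0 < e -> \forall n \near \oo, absv (u n - l) < e.
Proof. by rewrite cvg_ballP. Qed.

Lemma cvg_absvD u v l l' : u @ \oo --> l -> v @ \oo --> l' ->
  (u n + v n) @[n --> \oo] --> l + l'.
Proof.
move=> /cvg_absvP ul /cvg_absvP vl'; apply/cvg_absvP => e e0.
near=> n; rewrite opprD addrACA absvD_lt//; near: n; [exact: ul|exact: vl'].
Unshelve. all: by end_near. Qed.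

Lemma cvg_absvZ u l x : u @ \oo --> l -> (x * u n) @[n --> \oo] --> x * l.
Proof.
have [->|x0 /cvg_absvP ul] := eqVneq x 0.
  move=> _; rewrite mul0r; under eq_fun do rewrite mul0r; exact: cvg_cst.
have ax0 : 0 < absv x.
  rewrite lt_neqAle absv_ge0 andbT eq_sym.
  by apply/eqP => /absv_eq0/eqP; exact/negP.
apply/cvg_absvP => e e0; near=> n.
rewrite -mulrBr absvM mulrC -ltr_pdivlMr//; near: n; apply: ul.
by rewrite divr_gt0.
Unshelve. all: by end_near. Qed.

Lemma cvg_absvN u l : u @ \oo --> l -> (- u n) @[n --> \oo] --> - l.
Proof.
move=> ul; rewrite -mulN1r; under eq_fun do rewrite -mulN1r; exact: cvg_absvZ.
Qed.

Lemma cvg_absv_sum (I : Type) (r : seq I) (P : pred I)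
    (u : I -> nat -> K) (l : I -> K) :
  (forall i, P i -> u i @ \oo --> l i) ->
  (\sum_(i <- r | P i) u i n) @[n --> \oo] --> \sum_(i <- r | P i) l i.
Proof.
move=> ul; elim: r => [|i r IHr].
  by rewrite big_nil; under eq_fun do rewrite big_nil; exact: cvg_cst.
rewrite big_cons; under eq_fun do rewrite big_cons.
by case: ifPn => // Pi; apply: cvg_absvD => //; exact: ul.
Qed.

Lemma cvg_absv_geometric u l (c : R) : 0 <= c < 1 ->
  (forall n, absv (u n - l) <= c ^+ n) -> u @ \oo --> l.
Proof.
move=> /andP[c0 c1] uc; apply/cvg_absvP => e e0; near=> n.
apply: le_lt_trans (uc n) _; rewrite -[ltLHS]ger0_norm ?exprn_ge0//.
near: n; apply: cvgr0_norm_lt => //; apply: cvg_expr; by rewrite ger0_norm.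
Unshelve. all: by end_near. Qed.

Lemma cvg_absv_lim u l : u @ \oo --> l -> lim (u @ \oo) = l.
Proof. by move/cvg_lim; apply; exact: (@metric_hausdorff R K). Qed.

End Ultrametric.

(** * Characteristic zero, and the absolute value of 2 *)

Section Cp.
Variables (R : realType) (p : nat) (C : CpType R p).
Hypothesis p_prime : prime p.
Implicit Types (x y q : C).

Lemma Cp_abs_p_lt1 : absv (p%:R : C) < 1.
Proof. by rewrite Cp_abs_p invf_lt1 ?ltr0n ?prime_gt0// ltr1n prime_gt1. Qed.

(** The absolute value of [p] is nonzero, which excludes [p]. For a prime [l] other than [p], Bezout
    gives [1 + c * p = d * l]; if [l] vanished, 1 would equal [- (c * p)], of absolute value below
    1. *)
Lemma Cp_pchar0 : [pchar C] =i pred0.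
Proof.
move=> l; rewrite !inE; apply/negP => /andP[l_prime /eqP l0].
have [lp|lp] := eqVneq l p.
  move: l0 => /absv_eq0; rewrite lp Cp_abs_p => /eqP.
  by rewrite invr_eq0 pnatr_eq0 eqn0Ngt prime_gt0.
have /eqP g1 : coprime l p by rewrite prime_coprime// dvdn_prime2.
have [c _] := Bezoutl p (prime_gt0 l_prime); rewrite g1 => /dvdnP[d].
move/(congr1 (fun n => n%:R : C)); rewrite natrD !natrM l0 mulr0 => /eqP.
rewrite addr_eq0 => /eqP/(congr1 (@absv R C)); rewrite absv1 absvN absvM => cp.
suff: (1 : R) < 1 by rewrite ltxx.
rewrite [ltLHS]cp; apply: le_lt_trans Cp_abs_p_lt1.
by rewrite ler_piMl ?absv_ge0 ?absv_nat.
Qed.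

Lemma Cp_natr_eq0 n : (n%:R == 0 :> C) = (n == 0%N).
Proof. by move/pcharf0P: Cp_pchar0. Qed.

(** Since [p = 1 + 2 * p./2], a small 2 would make 1 small together with [p]. *)
Lemma Cp_abs2 : odd p -> absv (2 : C) = 1.
Proof.
move=> p_odd; apply/le_anti/andP; split; first exact: absv_nat.
rewrite leNgt; apply/negP => lt2.
suff: absv (1 : C) < 1 by rewrite absv1 ltxx.
have := congr1 (fun n => n%:R : C) (odd_double_half p).
rewrite p_odd natrD -mul2n natrM => /(canRL (addrK _)) h.
rewrite (h : 1 = _).
rewrite absvD_lt ?Cp_abs_p_lt1// absvN absvM.
by apply: le_lt_trans lt2; rewrite ler_piMr ?absv_ge0 ?absv_nat.
Qed.

(** * The binomial series at integer exponents *)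

Let gbin x k : C := (\prod_(i < k) (x - i%:R)) / k`!%:R.

Let gbin0 x : gbin x 0 = 1.
Proof. by rewrite /gbin big_ord0 fact0 divr1. Qed.

Let gbinS x k : gbin (x + 1) k.+1 = gbin x k.+1 + gbin x k.
Proof.
rewrite /gbin big_ord_recl big_ord_recr /= subr0 factS natrM.
under eq_bigr => i _ do
  rewrite /bump /= natrD opprD addrA addrK.
have k0 : k.+1%:R != 0 :> C by rewrite Cp_natr_eq0.
have f0 : k`!%:R != 0 :> C by rewrite Cp_natr_eq0 -lt0n fact_gt0.
set P := \prod_(_ < _) _; move: f0 k0; rewrite -natr1.
by move: (k%:R : C) (k`!%:R : C) => c d d0 c0; field; rewrite d0 c0.
Qed.

Let absv_gbinS x : (forall k, absv (gbin (x + 1) k) <= 1) <->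
  (forall k, absv (gbin x k) <= 1).
Proof.
split=> x1 [|k]; rewrite ?gbin0 ?absv1// ?gbinS ?absvD_le//.
(* From [x + 1] down to [x], Pascal's rule is solved for the coefficient of higher index, by
   induction on [k]. *)
elim: k => [|k IHk]; [have := x1 1|have := x1 k.+2]; rewrite gbinS ?gbin0 => h.
  by rewrite -[gbin _ _](addrK 1) absvD_le// absvN absv1.
by rewrite -[gbin _ _](addrK (gbin x k.+1)) absvD_le// absvN.
Qed.

(** The factorials in the denominators can be small, so the bound is not read off the formula: it is
    carried by Pascal's rule in both directions from 0, where only the coefficient of index 0
    survives. *)
Let absv_gbin (z : int) k : absv (gbin z%:~R k) <= 1.
Proof.
elim: z k => [|n IHn|n IHn].
- case=> [|k]; first by rewrite gbin0 absv1.
  by rewrite /gbin big_ord_recl subr0 !mul0r absv0.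
- by rewrite intS addrC intrD; apply/absv_gbinS.
- apply/absv_gbinS => k; have -> : (- n.+1%:Z)%:~R + 1 = (- n%:Z)%:~R :> C.
    by rewrite intS opprD intrD addrAC addNr add0r.
  exact: IHn.
Qed.

(** Negative exponents are included because of the factor [q^(-b xi)] in the integrand. *)
Lemma padic_pow_int q (z : int) : absv (q - 1) < 1 ->
  padic_pow q z%:~R = q ^ z.
Proof.
move=> q1; have q0 : q != 0 by rewrite absv_neq0// absv_unit.
pose t x k := gbin x k * (q - 1) ^+ k.
suff H : series (t z%:~R) @ \oo --> q ^ z by exact: cvg_absv_lim.
(* Pascal's rule, summed: shifting [x] by one multiplies the partial sums by [q]
   up to a single term, which tends to 0.  It is used in both directions. *)
have tS x n : series (t (x + 1)) n.+1 = q * series (t x) n + t x n.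
  elim: n => [|n IHn].
    by rewrite seriesSr /series/= !big_geq// /t gbin0 expr0 gbin0; ring.
  rewrite seriesSr IHn seriesSr /t gbinS exprS; ring.
have t0 (y : int) : t y%:~R @ \oo --> (0 : C).
  apply: (@cvg_absv_geometric _ _ _ _ (absv (q - 1))).
    by rewrite absv_ge0.
  move=> n; rewrite subr0 absvM absvX ler_piMl ?exprn_ge0 ?absv_ge0//.
elim: z => [|n IHn|n IHn].
(* At exponent 0 every nonempty partial sum is 1; the shift skips the empty one, which is 0. *)
- rewrite expr0z; rewrite -cvg_shiftS; rewrite (_ : (fun n => _) = fun=> 1).
    exact: cvg_cst.
  apply/funext => n; rewrite /series /= big_nat_recl//= /t gbin0 expr0 mulr1.
  rewrite big1_seq ?addr0// => k _.
  by rewrite /gbin big_ord_recl subr0 !mul0r.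
- rewrite intS addrC intrD; rewrite -cvg_shiftS.
  under eq_fun do rewrite tS.
  rewrite expfzDr// expr1z mulrC -[q * _]addr0.
  by apply: cvg_absvD (t0 _); apply: cvg_absvZ.
- have nE : (- n.+1%:Z)%:~R + 1 = (- n%:Z)%:~R :> C.
    by rewrite intS opprD intrD addrAC addNr add0r.
  have sE k : series (t (- n.+1%:Z)%:~R) k
      = q^-1 * (series (t (- n%:Z)%:~R) k.+1 - t (- n.+1%:Z)%:~R k).
    by rewrite -nE tS addrK mulKf.
  rewrite (funext sE).
  rewrite intS opprD expfzDr// exprN1 -[q ^ (- n%:Z)]subr0.
  apply: cvg_absvZ; apply: cvg_absvD; first by rewrite cvg_shiftS.
  exact/cvg_absvN/t0.
Qed.

(** * Arithmetic of q-numbers *)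

Lemma qnat_sum q n : qnat q n = \sum_(i < n) q ^+ i.
Proof.
rewrite /qnat; case: eqVneq => [->|q1].
  by under eq_bigr do rewrite expr1n; rewrite sumr_const card_ord.
have d0 : 1 - q != 0 by rewrite subr_eq0 eq_sym.
by rewrite -[LHS]mulrNN -invrN !opprB subrX1 mulrC mulKf // subr_eq0.
Qed.

Lemma qnat0 q : qnat q 0 = 0.
Proof. by rewrite qnat_sum big_ord0. Qed.

Lemma qnatS q n : qnat q n.+1 = 1 + q * qnat q n.
Proof.
rewrite !qnat_sum big_ord_recl expr0 mulr_sumr.
by under eq_bigr do rewrite exprS.
Qed.

(** The geometric sum is cut into [n] blocks of length [m]. *)
Lemma qnatM q m n : qnat q (m * n) = qnat q m * qnat (q ^+ m) n.
Proof.
elim: n => [|n IHn]; first by rewrite muln0 !qnat0 mulr0.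
rewrite mulnS qnatS mulrDr mulr1 mulrCA -IHn !qnat_sum big_split_ord /=.
by rewrite mulr_sumr; congr (_ + _); apply: eq_bigr => i _; rewrite exprD.
Qed.

Lemma subrX1_qnat q n : q ^+ n - 1 = (q - 1) * qnat q n.
Proof. by rewrite qnat_sum subrX1. Qed.

Lemma qnum_nat q n : absv (q - 1) < 1 -> qnum q n%:R = qnat q n.
Proof. by move=> q1; rewrite /qnum -[n%:R]/(n%:Z%:~R) padic_pow_int. Qed.

(** * q-numbers and powers of [q] along the exponents [p ^ N] *)

Section PrimePowers.
Variable q : C.
Hypothesis q1 : absv (q - 1) < 1.

Lemma absv_qnat n : absv (qnat q n) <= 1.
Proof.
rewrite qnat_sum; apply: absv_sum => // i _.
by rewrite absvX absv_unit ?expr1n.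
Qed.

Let r := Num.max (absv (p%:R : C)) (absv (q - 1)).

Let r_ge0 : 0 <= r. Proof. by rewrite le_max absv_ge0. Qed.

Let r_lt1 : r < 1. Proof. by rewrite gt_max Cp_abs_p_lt1. Qed.

(** By [qnatM], passing from [p ^ N] to [p ^ N.+1] multiplies by the q-number of [p] in base
    [q ^+ (p ^ N)]. This factor is [p] plus differences bounded by [absv (q - 1)], hence at most [r]
    in absolute value. *)
Let absv_qnat_expp N : absv (qnat q (p ^ N)) <= r ^+ N.
Proof.
elim: N => [|N IHN]; first by rewrite expr0 absv_qnat.
rewrite expnSr qnatM absvM exprSr ler_pM ?absv_ge0//.
have -> : qnat (q ^+ (p ^ N)) p
    = p%:R + \sum_(i < p) ((q ^+ (p ^ N)) ^+ i - 1).
  by rewrite qnat_sum sumrB sumr_const card_ord addrC subrK.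
apply: absvD_le; first by rewrite le_max lexx.
apply: absv_sum => // i _.
by rewrite -exprM le_max absv_exprB1 ?orbT.
Qed.

Lemma cvg_qnat_expp : qnat q (p ^ N) @[N --> \oo] --> (0 : C).
Proof.
apply: (@cvg_absv_geometric _ _ _ _ r); first by rewrite r_ge0.
by move=> N; rewrite subr0.
Qed.

Lemma cvg_expr_expp : q ^+ (p ^ N) @[N --> \oo] --> (1 : C).
Proof.
apply: (@cvg_absv_geometric _ _ _ _ r); first by rewrite r_ge0.
move=> N; rewrite subrX1_qnat absvM (le_trans _ (absv_qnat_expp N))//.
by rewrite ler_piMl ?absv_ge0 1?ltW.
Qed.

End PrimePowers.

(** * Alternating power sums of q-numbers *)

Definition alt_qnat_sum q m M : C :=
  \sum_(0 <= xi < M) (-1) ^+ xi * qnat q xi ^+ m.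

Lemma qnatS_expr q n m :
  qnat q n.+1 ^+ m = \sum_(j < m.+1) 'C(m, j)%:R * q ^+ j * qnat q n ^+ j.
Proof.
rewrite qnatS exprDn; apply: eq_bigr => j _.
by rewrite expr1n mul1r exprMn -mulrA mulr_natl.
Qed.

(** By [qnatS_expr] the first sum is the alternating sum of the shifted powers, so the total
    telescopes. Odd [M] gives the upper boundary term its plus sign; [0 ^+ m] is the lower one,
    equal to 1 when [m] is 0. *)
Lemma alt_qnat_sum_rec q m M : odd M ->
  \sum_(j < m.+1) 'C(m, j)%:R * q ^+ j * alt_qnat_sum q j M + alt_qnat_sum q m M
  = 0 ^+ m + qnat q M ^+ m.
Proof.
move=> M_odd.
have tele n :
    \sum_(0 <= xi < n) (-1) ^+ xi * (qnat q xi.+1 ^+ m + qnat q xi ^+ m)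
    = 0 ^+ m - (-1) ^+ n * qnat q n ^+ m.
  elim: n => [|n IHn]; first by rewrite big_geq// qnat0 expr0 mul1r subrr.
  by rewrite big_nat_recr//= IHn exprS; ring.
have := tele M; rewrite -signr_odd M_odd expr1 mulN1r opprK => <-.
rewrite [in RHS](eq_bigr _ (fun _ _ => mulrDr _ _ _)) big_split/=.
congr (_ + _); under [RHS]eq_bigr do rewrite qnatS_expr mulr_sumr.
rewrite exchange_big/=; apply: eq_bigr => j _; rewrite mulr_sumr.
by apply: eq_bigr => xi _; rewrite mulrCA.
Qed.

(** The approximant of the fermionic integral in base [B], after the weight [B ^+ xi] has been
    cancelled. *)
Definition alt_qnat_moment q B m N : C :=
  (qnat (- B) (p ^ N))^-1 * alt_qnat_sum q m (p ^ N).

(** * Convergence of the moments and their recurrence *)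

Section Moments.
Hypothesis p_odd : odd p.
Variables q B : C.
Hypotheses (q1 : absv (q - 1) < 1) (B1 : absv (B - 1) < 1).

Lemma absv_1D x : absv (x - 1) < 1 -> absv (1 + x) = 1.
Proof.
move=> x1; apply: (@absv_eq1 _ _ 2); rewrite ?Cp_abs2//.
by rewrite opprD addrACA subrr add0r.
Qed.

Lemma qnatN_odd x n : odd n -> 1 + x != 0 ->
  qnat (- x) n = (1 + x ^+ n) / (1 + x).
Proof.
move=> n_odd x0; rewrite /qnat opprK exprNn -signr_odd n_odd expr1 mulN1r opprK.
by rewrite eqr_oppLR -addr_eq0 addrC (negPf x0).
Qed.

Let addr1_neq0 x : absv (x - 1) < 1 -> 1 + x != 0.
Proof. by move=> x1; rewrite absv_neq0 ?absv_1D. Qed.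

Let weight N := (qnat (- B) (p ^ N))^-1.

Let weightE N : weight N = (1 + B) / (1 + B ^+ (p ^ N)).
Proof.
by rewrite /weight qnatN_odd ?oddX ?p_odd ?orbT ?addr1_neq0// invf_div.
Qed.

Let absv_exprB1_lt1 n : absv (B ^+ n - 1) < 1.
Proof. exact: le_lt_trans (absv_exprB1 _ _) B1. Qed.

Let absv_weight N : absv (weight N) = 1.
Proof. by rewrite weightE absvM absvV !absv_1D ?invr1 ?mulr1. Qed.

Let cvg_weight : weight N @[N --> \oo] --> (1 + B) / 2.
Proof.
have /cvg_absvP BM := cvg_expr_expp B1; apply/cvg_absvP => e /BM.
apply: filterS => N; apply: le_lt_trans.
have two0 : (2 : C) != 0 by rewrite absv_neq0 ?Cp_abs2.
have e0 := addr1_neq0 (absv_exprB1_lt1 (p ^ N)).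
(* The difference is [B ^+ (p ^ N) - 1] times a factor of absolute value 1, so both converge at the
   same rate. *)
have -> : weight N - (1 + B) / 2
    = (1 + B) / (2 * (1 + B ^+ (p ^ N))) * - (B ^+ (p ^ N) - 1).
  by rewrite weightE; field; rewrite e0 two0.
rewrite le_eqVlt !absvM absvV absvM absvN.
by rewrite Cp_abs2// !absv_1D// !(mulr1, mul1r, invr1) eqxx.
Qed.

Let moment_rec m N :
  \sum_(j < m.+1) 'C(m, j)%:R * q ^+ j * alt_qnat_moment q B j N
    + alt_qnat_moment q B m N
  = weight N * (0 ^+ m + qnat q (p ^ N) ^+ m).
Proof.
rewrite -alt_qnat_sum_rec ?oddX ?p_odd ?orbT// mulrDr mulr_sumr.
by congr (_ + _); apply: eq_bigr => j _; rewrite mulrCA.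
Qed.

(** For [m = 0] the bracket is 2 and cancels the denominator in the limit of the weight. For [m > 0]
    the product is bounded by [absv (qnat q (p ^ N))], which tends to 0. *)
Let cvg_moment_rhs m : weight N * (0 ^+ m + qnat q (p ^ N) ^+ m) @[N --> \oo]
  --> (m == 0)%:R * (1 + B).
Proof.
case: m => [|m] /=.
  have two0 : (2 : C) != 0 by rewrite absv_neq0 ?Cp_abs2.
  have -> : 1%:R * (1 + B) = 2 * ((1 + B) / 2) by rewrite mul1r mulrC divfK.
  by under eq_fun do rewrite !expr0 mulrC; exact: cvg_absvZ.
rewrite mul0r; have /cvg_absvP q0 := cvg_qnat_expp q1.
apply/cvg_absvP => e /q0; apply: filterS => N; apply: le_lt_trans.
rewrite !subr0 expr0n add0r absvM absv_weight mul1r exprS absvM.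
by rewrite ler_piMr ?absv_ge0// absvX exprn_ile1 ?absv_ge0 ?absv_qnat.
Qed.

(** [lim] takes a default value on divergent sequences, so convergence must be established first. In
    [moment_rec] the moment of order [m] has the total coefficient [1 + q ^+ m], which is nonzero;
    solving for it leaves only lower orders, and strong induction applies. *)
Let cvg_moment m :
  alt_qnat_moment q B m @ \oo --> lim (alt_qnat_moment q B m @ \oo).
Proof.
suff: exists l : C, alt_qnat_moment q B m @ \oo --> l.
  by move=> [l ml]; rewrite (cvg_absv_lim ml).
elim/ltn_ind: m => m IHm.
have {}IHm j : (j < m)%N ->
    alt_qnat_moment q B j @ \oo --> lim (alt_qnat_moment q B j @ \oo).
  by move=> /IHm[l ml]; rewrite (cvg_absv_lim ml).
have qm0 : 1 + q ^+ m != 0.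
  by apply: addr1_neq0; exact: le_lt_trans (absv_exprB1 _ _) q1.
exists ((1 + q ^+ m)^-1 * ((m == 0)%:R * (1 + B)
  - \sum_(j < m) 'C(m, j)%:R * q ^+ j * lim (alt_qnat_moment q B j @ \oo))).
have mE N : alt_qnat_moment q B m N = (1 + q ^+ m)^-1 *
    (weight N * (0 ^+ m + qnat q (p ^ N) ^+ m)
     - \sum_(j < m) 'C(m, j)%:R * q ^+ j * alt_qnat_moment q B j N).
  rewrite -moment_rec big_ord_recr/= binn mul1r.
  by set S := \sum_(_ < _) _; move: (alt_qnat_moment q B m N) => x; field.
rewrite (funext mE); apply: cvg_absvZ; apply: cvg_absvD => //.
apply: cvg_absvN; apply: cvg_absv_sum => j _; apply: cvg_absvZ; exact: IHm.
Qed.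

Lemma moment_lim_rec m :
  \sum_(j < m.+1) 'C(m, j)%:R * q ^+ j * lim (alt_qnat_moment q B j @ \oo)
    + lim (alt_qnat_moment q B m @ \oo) = (m == 0)%:R * (1 + B).
Proof.
rewrite -(cvg_absv_lim (@cvg_moment_rhs m)); apply/esym/cvg_absv_lim.
under eq_fun do rewrite -moment_rec.
apply: cvg_absvD (@cvg_moment m); apply: cvg_absv_sum => j _.
exact: cvg_absvZ.
Qed.

End Moments.

(** * Genocchi numbers as limits of moments *)

Lemma genocchiS q a b m : absv (q - 1) < 1 ->
  genocchi a b q m.+1
  = m.+1%:R * lim (alt_qnat_moment (q ^+ a) (q ^+ b) m @ \oo).
Proof.
move=> q1; have q0 : q != 0 by rewrite absv_neq0// absv_unit.
rewrite /genocchi /genocchi_poly /fermionic_int.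
congr (_ * _); apply: (congr1 (fun u => lim (u @ \oo))); apply/funext => N.
congr (_ * _); apply: eq_bigr => xi _.
rewrite add0r qnum_nat; last exact: le_lt_trans (absv_exprB1 _ q1) q1.
(* The exponent is an integer, so the binomial series becomes an ordinary power, inverse to the
   weight [(q ^+ b) ^+ xi]. *)
have -> : - (b%:R * xi%:R) = (- (b * xi)%:Z)%:~R :> C by rewrite mulrNz -natrM.
rewrite padic_pow_int// -exprnN exprM mulrA mulfV ?expf_neq0// mul1r.
by rewrite mulrC.
Qed.

End Cp.

(** * Umbral evaluation and the final identity *)

Lemma umbral_poly (K : nzRingType) (g : nat -> K) (E : nat -> K) n :
  umbral g (\poly_(k < n) E k) = \sum_(k < n) E k * g k.
Proof.
rewrite /umbral (big_ord_widen n (fun k => (\poly_(i < n) E i)`_k * g k))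
  ?size_poly//.
(* The size drops below [n] when the top values of [E] vanish; the summands beyond it are then 0. *)
rewrite [RHS](bigID (fun k : 'I_n => (k < size (\poly_(i < n) E i))%N))/=.
rewrite [X in _ + X]big1 ?addr0 => [|k].
  by apply: eq_bigr => k _; rewrite coef_poly ltn_ord.
rewrite -leqNgt => /(nth_default 0).
by rewrite coef_poly ltn_ord => ->; rewrite mul0r.
Qed.

Lemma umbral_affine_exp (K : comNzRingType) (g : nat -> K) (c : K) n :
  umbral g ((c *: 'X + 1) ^+ n) = \sum_(k < n.+1) c ^+ k *+ 'C(n, k) * g k.
Proof.
rewrite -(umbral_poly g (fun k => c ^+ k *+ 'C(n, k))); congr umbral.
rewrite poly_def addrC exprDn; apply: eq_bigr => k _.
by rewrite expr1n mul1r exprZn scalerMnl.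
Qed.

Theorem theorem3 (R : realType) (p : nat) (p_prime : prime p) (p_odd : odd p)
    (C : CpType R p) (q : C) (hq : absv (q - 1) < 1) (a b : nat) :
  genocchi a b q 0 = 0 /\
  forall n : nat, (0 < n)%N ->
    q ^- a * umbral (genocchi a b q) ((q ^+ a *: 'X + 1) ^+ n)
      + genocchi a b q n
    = if n == 1%N then qnat (q ^+ b) 2 else 0.
Proof.
split=> // -[//|m] _.
have q0 : q != 0 by rewrite absv_neq0// absv_unit.
have qX1 n : absv (q ^+ n - 1) < 1 by exact: le_lt_trans (absv_exprB1 n hq) hq.
have rec := moment_lim_rec p_prime p_odd (qX1 a) (qX1 b) m.
have qnat2 : qnat (q ^+ b) 2 = 1 + q ^+ b.
  by rewrite !qnatS qnat0 mulr0 addr0 mulr1.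
(* The term of index 0 drops out because the Genocchi number of index 0 is 0; the others are
   reindexed by [k = j + 1]. *)
rewrite umbral_affine_exp big_ord_recl mulr0 add0r mulr_sumr genocchiS//.
rewrite [X in X + _](_ : _ = m.+1%:R * \sum_(j < m.+1)
    'C(m, j)%:R * (q ^+ a) ^+ j *
    lim (alt_qnat_moment (q ^+ a) (q ^+ b) j @ \oo)%classic).
  by rewrite -mulrDr rec eqSS qnat2; case: m {rec} => [|m];
    rewrite ?mul1r ?mul0r ?mulr0.
rewrite mulr_sumr; apply: eq_bigr => j _.
rewrite lift0 genocchiS//.
(* Absorption trades the factor [j.+1] of the Genocchi number for the common factor [m.+1], while
   [q ^- a] lowers the exponent of [q ^+ a] from [j.+1] to [j]. *)
have := congr1 (fun n => n%:R : C) (mul_bin_diag m.+1 j); rewrite !natrM /=.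
rewrite !mulrA => ->; rewrite -mulr_natl exprS.
by field; rewrite expf_neq0.
Qed.
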